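(* Let $g$ be a finite two-person game and consider an $n$-$2$-$g$ iterative game. Let $\sigma$ be a Nash equilibrium of the projected game $g_p$, and let $\sigma'$ be a Nash equilibrium of the projected game $(g^T)_p$ of the transposed game. Then the minimized malicious payoff is achieved when a punishing agent plays the strategy of player 1 in $\sigma$ whenever it has the role of player 1 in $g$, and plays the strategy of player 1 in $\sigma'$ whenever it has the role of player 2 in $g$. That is: among all (possibly mixed) strategies $x$ of player 1 in $g$, the strategy of player 1 in $\sigma$ minimizes $\max_{y} P_2^g(x,y)$, where $y$ ranges over the mixed strategies of player 2 in $g$; and among all (possibly mixed) strategies $y$ of player 2 in $g$, the strategy of player 1 in $\sigma'$ minimizes $\max_{x} P_1^g(x,y)$, where $x$ ranges over the mixed strategies of player 1 in $g$.
   Context: A finite two-person game $g$ is given by finite nonempty strategy sets $S_1,S_2$ and payoffs $P_1^g(s,t),P_2^g(s,t)\in\mathbb{R}$ for players 1 and 2 when player 1 plays $s\in S_1$ and player 2 plays $t\in S_2$. Payoffs are extended to mixed strategies (probability distributions on $S_1$, $S_2$) by taking expectations. An $n$-$2$-$g$ iterative game consists of $n$ agents. The game $g$ is played repeatedly an unbounded number of times. At each iteration a pair of agents, selected uniformly at random, plays an instance of $g$ (one agent in the role of player 1, the other in the role of player 2). Some agents, called punishing agents, are controlled by the designer. Other agents, called malicious agents, do not follow the prescribed behavior and choose their strategies freely to maximize their expected payoff. The minimized malicious payoff is the minimal expected payoff of a malicious player that can be guaranteed by the punishing agents, i.e. in an encounter between a punishing agent and a malicious agent, the smallest upper bound on the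 malicious agent's expected payoff that the punishing agent can enforce by its choice of strategy, whatever the malicious agent plays (for each of the two roles the punishing agent may have). A two-person game is zero-sum if the players' payoffs sum to $0$ for every joint strategy; such a game is specified by player 1's payoff only. The projected game $g_p$ of $g$ is the two-person zero-sum game with the same strategy sets as $g$ in which player 1's payoff is $P^{g_p}(s,t)=-P_2^g(s,t)$. The transposed game $g^T$ is $g$ with the roles of the players exchanged: player 1 of $g^T$ has strategy set $S_2$, player 2 of $g^T$ has strategy set $S_1$, and $P_1^{g^T}(t,s)=P_2^g(s,t)$, $P_2^{g^T}(t,s)=P_1^g(s,t)$. Hence in $(g^T)_p$ player 1 has strategy set $S_2$ and payoff $-P_1^g(s,t)$ at the joint strategy $(t,s)$. A joint (mixed) strategy is a Nash equilibrium if no player can obtain a higher payoff by unilaterally changing its own strategy. *)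

(* Defs.v *)
From mathcomp Require Import all_boot all_order all_algebra.
From mathcomp Require Import classical_sets reals.
Set Implicit Arguments.
Unset Strict Implicit.
Unset Printing Implicit Defensive.
Import Order.TTheory GRing.Theory Num.Theory.
Local Open Scope classical_set_scope.
Local Open Scope ring_scope.

Record dist (R : realType) (T : finType) := Dist {
  mass :> {ffun T -> R};
  mass_ge0 : forall t, 0 <= mass t;
  mass_sum1 : \sum_t mass t = 1 }.

Record game (R : realType) := Game {
  strat1 : finType;
  strat2 : finType;
  strat1_gt0 : (0 < #|strat1|)%N;
  strat2_gt0 : (0 < #|strat2|)%N;
  pay1 : strat1 -> strat2 -> R;
  pay2 : strat1 -> strat2 -> R }.

Definition mixed1 (R : realType) (g : game R) := dist R (strat1 g).
Definition mixed2 (R : realType) (g : game R) := dist R (strat2 g).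

Definition expectation (R : realType) (S T : finType) (u : S -> T -> R)
    (x : dist R S) (y : dist R T) : R :=
  \sum_s \sum_t x s * y t * u s t.

Definition epay1 (R : realType) (g : game R) (x : mixed1 g) (y : mixed2 g) : R :=
  expectation (@pay1 R g) x y.
Definition epay2 (R : realType) (g : game R) (x : mixed1 g) (y : mixed2 g) : R :=
  expectation (@pay2 R g) x y.

Definition nash (R : realType) (g : game R) (sigma : mixed1 g * mixed2 g) : Prop :=
  (forall x : mixed1 g, epay1 x sigma.2 <= epay1 sigma.1 sigma.2) /\
  (forall y : mixed2 g, epay2 sigma.1 y <= epay2 sigma.1 sigma.2).

Definition zero_sum_game (R : realType) (S T : finType) (S_gt0 : (0 < #|S|)%N)
    (T_gt0 : (0 < #|T|)%N) (u : S -> T -> R) : game R :=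
  Game S_gt0 T_gt0 u (fun s t => - u s t).

Definition projected (R : realType) (g : game R) : game R :=
  zero_sum_game (strat1_gt0 g) (strat2_gt0 g) (fun s t => - pay2 s t).

Definition transposed (R : realType) (g : game R) : game R :=
  Game (strat2_gt0 g) (strat1_gt0 g)
    (fun t s => pay2 s t) (fun t s => pay1 s t).

Definition is_maximum (R : realType) (A : set R) (v : R) : Prop :=
  A v /\ ubound A v.
Definition is_minimum (R : realType) (A : set R) (v : R) : Prop :=
  A v /\ lbound A v.

(* The first conjunct says that every maximum over y is attained, so that the
   comparison of maxima in the second one is never vacuous. *)
Definition minimizes_max (R : realType) (X Y : Type) (f : X -> Y -> R) (x : X) :
    Prop :=
  (forall x' : X, exists v : R, is_maximum (range (f x')) v) /\
  (forall (x' : X) (v v' : R),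
     is_maximum (range (f x)) v -> is_maximum (range (f x')) v' -> v <= v').

(* pairing (i, j) is the probability that, at an iteration, i and j are
   selected with i as player 1 and j as player 2.  Only the unordered pair is
   required to be uniform; how the two roles are then allotted is left free.
   Agents need not be punishing or malicious. *)
Record iterative_game (R : realType) (n : nat) (g : game R) := IterativeGame {
  punishing : {set 'I_n};
  malicious : {set 'I_n};
  punishing_malicious : forall i : 'I_n, i \in punishing -> i \notin malicious;
  pairing : dist R ('I_n * 'I_n)%type;
  pairing_diag : forall i : 'I_n, pairing (i, i) = 0;
  pairing_uniform : forall i j : 'I_n, i != j ->
    pairing (i, j) + pairing (j, i) = ('C(n, 2))%:R^-1 }.

(* Past iterations: the selected (player 1, player 2), and what they played. *)
Definition history (R : realType) (n : nat) (g : game R) :=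
  seq (('I_n * 'I_n) * (strat1 g * strat2 g)).

(* The choice made in each role may depend on the history and the opponent. *)
Record agent_strategy (R : realType) (n : nat) (g : game R) := AgentStrategy {
  as_player1 : history n g -> 'I_n -> mixed1 g;
  as_player2 : history n g -> 'I_n -> mixed2 g }.

Definition stationary (R : realType) (n : nat) (g : game R)
    (x : mixed1 g) (y : mixed2 g) : agent_strategy n g :=
  AgentStrategy (fun _ _ => x) (fun _ _ => y).

Inductive role := Player1 | Player2.

(* In what follows r is the role of the punishing agent p, which meets the
   malicious agent m after history h; a and b are the strategies of p and m. *)
Definition encounter (n : nat) (r : role) (p m : 'I_n) : 'I_n * 'I_n :=
  match r with Player1 => (p, m) | Player2 => (m, p) end.

Definition malicious_payoff (R : realType) (n : nat) (g : game R) (r : role)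
    (h : history n g) (p m : 'I_n) (a b : agent_strategy n g) : R :=
  match r with
  | Player1 => epay2 (as_player1 a h m) (as_player2 b h p)
  | Player2 => epay1 (as_player1 b h p) (as_player2 a h m)
  end.

Definition enforces (R : realType) (n : nat) (g : game R) (r : role)
    (h : history n g) (p m : 'I_n) (a : agent_strategy n g) (v : R) : Prop :=
  forall b : agent_strategy n g, malicious_payoff r h p m a b <= v.

Definition minimized_malicious_payoff (R : realType) (n : nat) (g : game R)
    (r : role) (h : history n g) (p m : 'I_n) (v : R) : Prop :=
  is_minimum [set w | exists a : agent_strategy n g, enforces r h p m a w] v.

Definition achieves_minimized_malicious_payoff (R : realType) (n : nat)
    (g : game R) (r : role) (h : history n g) (p m : 'I_n)
    (a : agent_strategy n g) : Prop :=
  exists v : R,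
    minimized_malicious_payoff r h p m v /\ enforces r h p m a v.

(* Main.v *)
(* A Nash equilibrium of the projected game is a saddle point of the malicious
   payoff.  Its value is enforced by the first component, and it cannot be
   improved because the second component yields at least that value against
   any strategy of the punishing agent. *)

Require Import Defs.
From mathcomp Require Import all_boot all_order all_algebra.
From mathcomp Require Import classical_sets reals.
Set Implicit Arguments.
Unset Strict Implicit.
Unset Printing Implicit Defensive.
Import Order.TTheory GRing.Theory Num.Theory.
Local Open Scope ring_scope.

Lemma expectation_transpose (R : realType) (S T : finType) (u : S -> T -> R)
    (x : dist R S) (y : dist R T) :
  expectation (fun t s => u s t) y x = expectation u x y.
Proof.
rewrite /expectation exchange_big; apply: eq_bigr => s _.
by apply: eq_bigr => t _; rewrite (mulrC (y t)).
Qed.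

Lemma expectationN (R : realType) (S T : finType) (u : S -> T -> R)
    (x : dist R S) (y : dist R T) :
  expectation (fun s t => - u s t) x y = - expectation u x y.
Proof.
rewrite /expectation -sumrN; apply: eq_bigr => s _.
by rewrite -sumrN; apply: eq_bigr => t _; rewrite mulrN.
Qed.

Lemma pure_ge0 (R : realType) (T : finType) (t0 t : T) :
  0 <= [ffun t' => (t' == t0)%:R : R] t.
Proof. by rewrite ffunE ler0n. Qed.

Lemma pure_sum1 (R : realType) (T : finType) (t0 : T) :
  \sum_t [ffun t' => (t' == t0)%:R : R] t = 1.
Proof.
rewrite (bigD1 t0) //= ffunE eqxx big1 ?addr0 // => t /negbTE t_neq.
by rewrite ffunE t_neq.
Qed.

Definition pure (R : realType) (T : finType) (t0 : T) : dist R T :=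
  Dist (pure_ge0 R t0) (pure_sum1 R t0).

Lemma expectationEr (R : realType) (S T : finType) (u : S -> T -> R)
    (x : dist R S) (y : dist R T) :
  expectation u x y = \sum_t y t * \sum_s x s * u s t.
Proof.
rewrite /expectation exchange_big; apply: eq_bigr => t _.
by rewrite mulr_sumr; apply: eq_bigr => s _; rewrite mulrA (mulrC (y t)).
Qed.

Lemma expectation_pure (R : realType) (S T : finType) (u : S -> T -> R)
    (x : dist R S) (t : T) :
  expectation u x (pure R t) = \sum_s x s * u s t.
Proof.
rewrite expectationEr (bigD1 t) //= ffunE eqxx mul1r [X in _ + X]big1 ?addr0 //.
by move=> t' /negbTE t'_neq; rewrite ffunE t'_neq mul0r.
Qed.

(** Against a fixed [x] the payoff is linear in [y], hence an average of the payoffs of pure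
    replies. A best pure reply, which exists because [T] is finite and nonempty, is therefore a best
    reply among mixed ones; no compactness argument is involved. *)
Lemma expectation_max_attained (R : realType) (S T : finType) (u : S -> T -> R)
    (x : dist R S) :
  (0 < #|T|)%N -> exists v : R, is_maximum (range (expectation u x)) v.
Proof.
case/card_gt0P => t0 _.
have [t _ t_max] := @arg_maxP _ R T t0 predT (fun t => \sum_s x s * u s t) isT.
exists (expectation u x (pure R t)); split; first by exists (pure R t).
move=> _ [y _ <-]; rewrite expectation_pure expectationEr.
(* The bound is spread over the masses of [y], which sum to 1, so that the two averages compare term
   by term. *)
rewrite -[leRHS]mul1r -(mass_sum1 y) mulr_suml; apply: ler_sum => t' _.
by apply: ler_wpM2l; [apply: mass_ge0 | apply: t_max].
Qed.

Definition saddle_point (R : realType) (X Y : Type) (f : X -> Y -> R)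
    (x0 : X) (y0 : Y) : Prop :=
  (forall x, f x0 y0 <= f x y0) /\ (forall y, f x0 y <= f x0 y0).

(** For any [x], the chain [f x0 y <= f x0 y0 <= f x y0] ends below the maximum of [f x]. *)
Lemma saddle_point_minimizes_max (R : realType) (X Y : Type) (f : X -> Y -> R)
    (x0 : X) (y0 : Y) :
  (forall x, exists v : R, is_maximum (range (f x)) v) ->
  saddle_point f x0 y0 -> minimizes_max f x0.
Proof.
move=> f_max [x0_min y0_max]; split=> // x v v' [[y _ <-] _] [_ v'_ub].
apply: le_trans (y0_max y) (le_trans (x0_min x) _).
by apply: v'_ub; exists y0.
Qed.

(** Player 1 of [projected g] receives [- pay2], so its best replies minimize [epay2]; player 2
    receives the opposite of that, so the double negation makes it a maximizer of [epay2]. *)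
Lemma nash_projected_saddle (R : realType) (g : game R)
    (sigma : mixed1 (projected g) * mixed2 (projected g)) :
  nash sigma ->
  saddle_point (fun (x : mixed1 g) (y : mixed2 g) => epay2 x y)
    sigma.1 sigma.2.
Proof.
case=> nash1 nash2; split=> [x | y].
- by have := nash1 x; rewrite /epay1 !expectationN lerN2.
- by have := nash2 y; rewrite /epay2 !expectationN !opprK.
Qed.

Lemma saddle_points_achieve (R : realType) (g : game R) (n : nat) (r : role)
    (h : history n g) (p m : 'I_n) (x x' : mixed1 g) (y y' : mixed2 g) :
  saddle_point (fun (x : mixed1 g) (y : mixed2 g) => epay2 x y) x y' ->
  saddle_point (fun (y : mixed2 g) (x : mixed1 g) => epay1 x y) y x' ->
  achieves_minimized_malicious_payoff r h p m (stationary n x y).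
Proof.
move=> [x_min y'_max] [y_min x'_max].
(* This is the saddle value for role [r]: [epay2 x y'] for [Player1] and [epay1 x' y] for
   [Player2]. *)
set v := malicious_payoff r h p m (stationary n x y) (stationary n x' y').
have v_enforced : enforces r h p m (stationary n x y) v.
  by rewrite /v; case: r {v} => b; [apply: y'_max | apply: x'_max].
exists v; split=> //; split; first by exists (stationary n x y).
(* A bound [w] enforced by [a] holds in particular against the stationary opponent playing [x'] and
   [y'], whose payoff against any [a] is at least [v]. *)
move=> w [a /(_ (stationary n x' y'))]; apply: le_trans.
by rewrite /v; case: r {v v_enforced}; [apply: x_min | apply: y_min].
Qed.

Theorem theorem1 (R : realType) (g : game R) (n : nat) (G : iterative_game n g)
    (sigma : mixed1 (projected g) * mixed2 (projected g))
    (sigma' : mixed1 (projected (transposed g)) *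
              mixed2 (projected (transposed g)))
    (sigma_nash : nash sigma) (sigma'_nash : nash sigma') :
  [/\ forall (r : role) (h : history n g) (p m : 'I_n),
        p \in punishing G -> m \in malicious G ->
        0 < pairing G (encounter r p m) ->
        achieves_minimized_malicious_payoff r h p m
          (stationary n (sigma.1 : mixed1 g) (sigma'.1 : mixed2 g)),
      minimizes_max (fun (x : mixed1 g) (y : mixed2 g) => epay2 x y)
        (sigma.1 : mixed1 g)
    & minimizes_max (fun (y : mixed2 g) (x : mixed1 g) => epay1 x y)
        (sigma'.1 : mixed2 g)].
Proof.
have saddle := nash_projected_saddle sigma_nash.
have saddle' : saddle_point (fun (y : mixed2 g) (x : mixed1 g) => epay1 x y)
    sigma'.1 sigma'.2.
  (* In [transposed g] the second payoff is [pay1] with its arguments swapped, so this saddle point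
     concerns [epay1] up to exchanging the two sums. *)
  have [y_min x_max] := nash_projected_saddle sigma'_nash.
  split=> [y | x]; rewrite /epay1 -!(expectation_transpose (@pay1 R g)).
    exact: y_min.
  exact: x_max.
split.
- by move=> r h p m _ _ _; apply: saddle_points_achieve saddle saddle'.
- apply: saddle_point_minimizes_max saddle => x.
  exact: expectation_max_attained (strat2_gt0 g).
- apply: saddle_point_minimizes_max saddle' => y.
  (* Here the maximum runs over player 1, so attainment is applied to the swapped payoff, in which
     [x] is the second argument. *)
  have [v [[x _ <-] v_ub]] :=
    expectation_max_attained (fun t s => @pay1 R g s t) y (strat1_gt0 g).
  exists (epay1 x y); split; first by exists x.
  move=> _ [x' _ <-]; rewrite /epay1 -!(expectation_transpose (@pay1 R g)).
  by apply: v_ub; exists x'.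
Qed.
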